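(* Let $n\ge 1$, and let $u=u_{z_1,\bar z_2}$ be a bivariate linear functional with quasidefinite Gram matrix $G$. (i) Let $L^{(1)}(z)=L^{(1)}_nz^n+\dots+L^{(1)}_{-n}z^{-n}$, $L^{(1)}_nL^{(1)}_{-n}\ne 0$, be a prepared Laurent polynomial, let $\hat u^{(1)}=L^{(1)}(z_1)u$, and assume that the Gram matrix $\hat G^{(1)}$ of $\hat u^{(1)}$ is quasidefinite. Put $$\hat\tau^{(1)}_l:=\begin{vmatrix}\mathcal J^{L^{(1)}}_{\phi_{1,l}}\\ \vdots\\ \mathcal J^{L^{(1)}}_{\phi_{1,l+2n-1}}\end{vmatrix}.$$ If $l\ge 2n$ and $\hat\tau^{(1)}_l\neq 0$, then $$\hat\phi^{(1)}_{1,l}(z)=\frac{L^{(1)}_{(-1)^ln}}{L^{(1)}(z)}\,\Theta_*\begin{bmatrix}\mathcal J^{L^{(1)}}_{\phi_{1,l}}&\phi_{1,l}(z)\\ \vdots&\vdots\\ \mathcal J^{L^{(1)}}_{\phi_{1,l+2n}}&\phi_{1,l+2n}(z)\end{bmatrix}=\frac{L^{(1)}_{(-1)^ln}}{L^{(1)}(z)}\frac1{\hat\tau^{(1)}_l}\begin{vmatrix}\mathcal J^{L^{(1)}}_{\phi_{1,l}}&\phi_{1,l}(z)\\ \vdots&\vdots\\ \mathcal J^{L^{(1)}}_{\phi_{1,l+2n}}&\phi_{1,l+2n}(z)\end{vmatrix},$$ $$\hat H^{(1)}_l=L^{(1)}_{(-1)^ln}H_l\,\Theta_*\begin{bmatrix}\mathcal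 J^{L^{(1)}}_{\phi_{1,l}}&1\\ \mathcal J^{L^{(1)}}_{\phi_{1,l+1}}&0\\ \vdots&\vdots\\ \mathcal J^{L^{(1)}}_{\phi_{1,l+2n}}&0\end{bmatrix}=L^{(1)}_{(-1)^ln}H_l\frac{\hat\tau^{(1)}_{l+1}}{\hat\tau^{(1)}_l},$$ $$\overline{\hat\phi^{(1)}_{2,l}(z)}=\frac{\hat H^{(1)}_l}{L^{(1)}_{(-1)^ln}}\,\Theta_*\begin{bmatrix}\mathcal J^{L^{(1)}}_{\phi_{1,l+1}}&0\\ \vdots&\vdots\\ \mathcal J^{L^{(1)}}_{\phi_{1,l+2n-1}}&0\\ \mathcal J^{L^{(1)}}_{\phi_{1,l+2n}}&1\\ \mathcal J^{L^{(1)}}_{K^{[l+1]}}(\bar z)&0\end{bmatrix}=-\frac{H_l}{\hat\tau^{(1)}_l}\begin{vmatrix}\mathcal J^{L^{(1)}}_{\phi_{1,l+1}}\\ \vdots\\ \mathcal J^{L^{(1)}}_{\phi_{1,l+2n-1}}\\ \mathcal J^{L^{(1)}}_{K^{[l+1]}}(\bar z)\end{vmatrix}.$$ (ii) Let $L^{(2)}(z)=L^{(2)}_nz^n+\dots+L^{(2)}_{-n}z^{-n}$, $L^{(2)}_nL^{(2)}_{-n}\ne 0$, be a prepared Laurent polynomial, let $\hat u^{(2)}=u\,\overline{L^{(2)}(z_2)}$, and assume that its Gram matrix $\hat G^{(2)}$ is quasidefinite. Put $$\hat\tau^{(2)}_l:=\begin{vmatrix}\mathcal J^{L^{(2)}}_{\phi_{2,l}}\\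 \vdots\\ \mathcal J^{L^{(2)}}_{\phi_{2,l+2n-1}}\end{vmatrix}.$$ If $l\ge 2n$ and $\hat\tau^{(2)}_l\ne 0$, then $$\hat\phi^{(2)}_{2,l}(z)=\frac{L^{(2)}_{(-1)^ln}}{L^{(2)}(z)}\,\Theta_*\begin{bmatrix}\mathcal J^{L^{(2)}}_{\phi_{2,l}}&\phi_{2,l}(z)\\ \vdots&\vdots\\ \mathcal J^{L^{(2)}}_{\phi_{2,l+2n}}&\phi_{2,l+2n}(z)\end{bmatrix}=\frac{L^{(2)}_{(-1)^ln}}{L^{(2)}(z)}\frac1{\hat\tau^{(2)}_l}\begin{vmatrix}\mathcal J^{L^{(2)}}_{\phi_{2,l}}&\phi_{2,l}(z)\\ \vdots&\vdots\\ \mathcal J^{L^{(2)}}_{\phi_{2,l+2n}}&\phi_{2,l+2n}(z)\end{vmatrix},$$ $$\overline{\hat H^{(2)}_l}=L^{(2)}_{(-1)^ln}\overline{H_l}\,\Theta_*\begin{bmatrix}\mathcal J^{L^{(2)}}_{\phi_{2,l}}&1\\ \mathcal J^{L^{(2)}}_{\phi_{2,l+1}}&0\\ \vdots&\vdots\\ \mathcal J^{L^{(2)}}_{\phi_{2,l+2n}}&0\end{bmatrix}=L^{(2)}_{(-1)^ln}\overline{H_l}\frac{\hat\tau^{(2)}_{l+1}}{\hat\tau^{(2)}_l},$$ $$\overline{\hat\phi^{(2)}_{1,l}(z)}=\frac{\overline{\hat H^{(2)}_l}}{L^{(2)}_{(-1)^ln}}\,\Theta_*\begin{bmatrix}\mathcal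 J^{L^{(2)}}_{\phi_{2,l+1}}&0\\ \vdots&\vdots\\ \mathcal J^{L^{(2)}}_{\phi_{2,l+2n-1}}&0\\ \mathcal J^{L^{(2)}}_{\phi_{2,l+2n}}&1\\ \mathcal J^{L^{(2)}}_{\overline{K^{[l+1]}}}(\bar z)&0\end{bmatrix}=-\frac{\overline{H_l}}{\hat\tau^{(2)}_l}\begin{vmatrix}\mathcal J^{L^{(2)}}_{\phi_{2,l+1}}\\ \vdots\\ \mathcal J^{L^{(2)}}_{\phi_{2,l+2n-1}}\\ \mathcal J^{L^{(2)}}_{\overline{K^{[l+1]}}}(\bar z)\end{vmatrix}.$$
   Context: Indices of vectors and matrices start at $0$. CMV sequence: $\chi(z)=[1,z^{-1},z,z^{-2},z^2,\dots]^\top$, i.e. $\chi^{(2k)}(z)=z^k$, $\chi^{(2k+1)}(z)=z^{-k-1}$. A bivariate linear functional $u=u_{z_1,\bar z_2}$ is a (continuous) linear functional on the span of the functions $f(z_1)\otimes\overline{g(z_2)}:=f(z_1)\overline{g(z_2)}$, $f,g\in\mathbb C[z,z^{-1}]$; it defines the sesquilinear form $\langle f(z_1),g(z_2)\rangle_u=\langle u,f(z_1)\otimes\overline{g(z_2)}\rangle$ and the Gram matrix $G$ with entries $G_{k,l}=\langle\chi^{(k)},\chi^{(l)}\rangle_u$. A semi-infinite matrix is quasidefinite if all its leading principal minors are nonzero; then there is a unique factorization $G=S_1^{-1}H(S_2^{-1})^\dagger$ with $S_1,S_2$ lower unitriangular and $H=\operatorname{diag}(H_0,H_1,\dots)$ with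 nonzero diagonal. The biorthogonal Laurent polynomials are $\phi_a(z)=S_a\chi(z)=[\phi_{a,0}(z),\phi_{a,1}(z),\dots]^\top$, $a=1,2$; $\langle\phi_{1,k},\phi_{2,l}\rangle_u=\delta_{k,l}H_k$. The Christoffel–Darboux kernel is $K^{[l]}(\bar z_1,z_2)=\sum_{k=0}^{l-1}\overline{\phi_{2,k}(z_1)}H_k^{-1}\phi_{1,k}(z_2)$. Perturbed functionals: $\langle \hat u^{(1)},f\otimes\bar g\rangle=\langle u,L^{(1)}f\otimes\bar g\rangle$, $\langle\hat u^{(2)},f\otimes\bar g\rangle=\langle u,f\otimes\overline{L^{(2)}g}\rangle$. Quantities with a hat and superscript $(a)$ ($\hat H^{(a)}_k$, $\hat\phi^{(a)}_{1,k}$, $\hat\phi^{(a)}_{2,k}$) are the corresponding objects for $\hat u^{(a)}$. A Laurent polynomial is prepared if it has the form $L(z)=L_nz^n+\dots+L_{-n}z^{-n}$ with $L_nL_{-n}\ne0$; $L_{(-1)^ln}$ means $L_n$ for $l$ even and $L_{-n}$ for $l$ odd. If $L$ has zeros $\zeta_1,\dots,\zeta_d\in\mathbb C^*$ with multiplicities $m_1,\dots,m_d$ ($\sum m_i=2n$), the spectral jet of $f$ along $L$ is the row vector $$\mathcal J^L_f=\Big[f(\zeta_1),f'(\zeta_1),\dots,\tfrac{f^{(m_1-1)}(\zeta_1)}{(m_1-1)!},\dots,f(\zeta_d),f'(\zeta_d),\dots,\tfrac{f^{(m_d-1)}(\zeta_d)}{(m_d-1)!}\Big]\in\mathbb C^{2n}.$$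 $\mathcal J^{L^{(1)}}_{K^{[l]}}(\bar z)$ is the jet of $z_2\mapsto K^{[l]}(\bar z,z_2)$; $\mathcal J^{L^{(2)}}_{\overline{K^{[l]}}}(\bar z)$ is the jet of $z_1\mapsto\overline{K^{[l]}(\bar z_1,z)}$. For a square invertible block $A$, column $B$, row $C$, scalar $D$, the last quasideterminant is $\Theta_*\begin{bmatrix}A&B\\C&D\end{bmatrix}=D-CA^{-1}B=\begin{vmatrix}A&B\\C&D\end{vmatrix}/|A|$. *)

(* Defs.v *)
From HB Require Import structures.
From mathcomp Require Import all_boot all_order all_algebra.
From mathcomp Require Import boolp classical_sets reals.
From mathcomp Require Import complex finmap monalg.

(* The field of complex numbers is R[i], for R : realType. *)

Set Implicit Arguments.
Unset Strict Implicit.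
Unset Printing Implicit Defensive.

Import Order.TTheory GRing.Theory Num.Theory.
Local Open Scope ring_scope.

Section LinearExtension.
Context {K : choiceType} {A : comNzRingType} {V : lmodType A}.

(* The linear map from the free module on K that sends the basis vector
   << k >> to b k. *)
Definition malg_lin (b : K -> V) (g : {malg A[K]}) : V :=
  \sum_(k <- msupp g) g@_k *: b k.

Lemma malg_linw (b : K -> V) (g : {malg A[K]}) (d : {fset K}) :
  (msupp g `<=` d)%fset -> malg_lin b g = \sum_(k <- d) g@_k *: b k.
Proof.
move=> gd; apply: big_fset_incl => // k _ /mcoeff_outdom ->.
by rewrite scale0r.
Qed.

Fact malg_lin_linear (b : K -> V) : linear (malg_lin b).
Proof.
move=> c f g.
set d := (msupp f `|` msupp g)%fset.
have sf : (msupp f `<=` d)%fset by apply: fsubsetUl.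
have sg : (msupp g `<=` d)%fset by apply: fsubsetUr.
have scf : (msupp (c *: f) `<=` d)%fset by apply: fsubset_trans (msuppZ_le _ _) sf.
have sfg : (msupp (c *: f + g) `<=` d)%fset.
  by apply: fsubset_trans (msuppD_le _ _) _; rewrite fsubUset scf sg.
rewrite (malg_linw b sf) (malg_linw b sg) (malg_linw b sfg) scaler_sumr -big_split.
by apply: eq_bigr => k _; rewrite mcoeffD mcoeffZ scalerDl scalerA.
Qed.

HB.instance Definition _ (b : K -> V) :=
  GRing.isLinear.Build A {malg A[K]} V *:%R (malg_lin b) (malg_lin_linear b).

Lemma malg_linU (b : K -> V) (c : A) (k : K) :
  malg_lin b << c *g k >> = c *: b k.
Proof. by rewrite (malg_linw b msuppU_le) big_seq_fset1 mcoeffUU. Qed.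

Lemma eq_malg_lin (b b' : K -> V) (g : {malg A[K]}) :
  b =1 b' -> malg_lin b g = malg_lin b' g.
Proof. by move=> e; apply: eq_bigr => k _; rewrite e. Qed.

End LinearExtension.

Lemma malg_lin_comp (K : choiceType) (A : comNzRingType) (V W : lmodType A)
    (phi : {linear V -> W}) (b : K -> V) (g : {malg A[K]}) :
  phi (malg_lin b g) = malg_lin (phi \o b) g.
Proof. by rewrite linear_sum; apply: eq_bigr => k _; rewrite linearZ. Qed.

Lemma malg_lin_exchange (K K' : choiceType) (A : comNzRingType) (V : lmodType A)
    (c : K -> K' -> V) (f : {malg A[K]}) (g : {malg A[K']}) :
  malg_lin (fun i => malg_lin (c i) g) f =
  malg_lin (fun j => malg_lin (c^~ j) f) g.
Proof.
rewrite /malg_lin; under eq_bigr do rewrite scaler_sumr.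
rewrite exchange_big /=; apply: eq_bigr => j _; rewrite scaler_sumr.
by apply: eq_bigr => i _; rewrite !scalerA mulrC.
Qed.

Section LaurentPolynomials.
Variable R : realType.
Local Notation C := R[i]%C.

(* C[z, z^-1]: the coefficient of z^k in f is f@_k, and << c *g k >> = c z^k. *)
Definition laurent := {malg C[int]}.

(* The span of the functions f(z1) (g(z2))^*: the basis vector << (i, j) >>
   is the function z1^i (z2^* )^j, and these functions are independent. *)
Definition laurent2 := {malg C[(int * int)%type]}.

Definition leval (f : laurent) (z : C) : C :=
  malg_lin (fun k : int => z ^ k : C^o) f.

Definition lmul (f g : laurent) : laurent :=
  malg_lin (fun i : int => malg_lin (fun j : int => << (i + j)%R >> : laurent) g) f.

(* The Laurent polynomial fbar with fbar(z^* ) = (f(z))^*. *)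
Definition lconj (f : laurent) : laurent :=
  \sum_(k <- msupp f) << (f@_k)^* *g k >>.

Definition lderiv (f : laurent) : laurent :=
  malg_lin (fun k : int => << k%:~R *g (k - 1)%R >> : laurent) f.

(* The function f(z1) (g(z2))^*. *)
Definition tens (f g : laurent) : laurent2 :=
  malg_lin (fun i : int =>
    malg_lin (fun j : int => << (i, j) >> : laurent2) (lconj g)) f.

(* L(z1) h(z1, z2^* ) and (L(z2))^* h(z1, z2^* ). *)
Definition mulz1 (L : laurent) (h : laurent2) : laurent2 :=
  malg_lin (fun p : int * int =>
    malg_lin (fun k : int => << (k + p.1, p.2) >> : laurent2) L) h.
Definition mulz2c (L : laurent) (h : laurent2) : laurent2 :=
  malg_lin (fun p : int * int =>
    malg_lin (fun k : int => << (p.1, k + p.2) >> : laurent2) (lconj L)) h.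

HB.instance Definition _ (L : laurent) :=
  GRing.isLinear.Build C laurent2 laurent2 *:%R (mulz1 L) (malg_lin_linear _).
HB.instance Definition _ (L : laurent) :=
  GRing.isLinear.Build C laurent2 laurent2 *:%R (mulz2c L) (malg_lin_linear _).

(* All linear functionals: every one is continuous for the finest locally
   convex topology of laurent2. *)
Definition functional := {scalar laurent2}.

Definition perturb1 (L : laurent) (u : functional) : functional :=
  u \o mulz1 L.
Definition perturb2 (L : laurent) (u : functional) : functional :=
  u \o mulz2c L.

Lemma mcoeff_lconj (f : laurent) (k : int) : (lconj f)@_k = (f@_k)^*.
Proof.
rewrite raddf_sum /=; case: (msuppP f k) => [kf|kf].
  rewrite (big_fsetD1 k) //= mcoeffUU big1_fset ?addr0 // => k'.
  by rewrite in_fsetD1 mcoeffU; case: eqP.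
rewrite conjC0 big1_fset // => k' k'f _; rewrite mcoeffU.
by case: eqP k'f kf => // -> ->.
Qed.

Lemma msupp_lconj (f : laurent) : msupp (lconj f) = msupp f.
Proof.
by apply/fsetP => k; rewrite -!mcoeff_neq0 mcoeff_lconj conjC_eq0.
Qed.

Lemma mcoeff_lmul (f g : laurent) (k : int) :
  (lmul f g)@_k =
    \sum_(i <- msupp f) \sum_(j <- msupp g) f@_i * g@_j *+ (i + j == k).
Proof.
rewrite /lmul /malg_lin raddf_sum; apply: eq_bigr => i _ /=.
rewrite mcoeffZ raddf_sum mulr_sumr; apply: eq_bigr => j _ /=.
by rewrite mcoeffZ mcoeffU mulr_natr mulrnAr.
Qed.

Lemma lconj_lmul (f g : laurent) : lconj (lmul f g) = lmul (lconj f) (lconj g).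
Proof.
apply/malgP => k.
rewrite mcoeff_lconj.
rewrite [in RHS]mcoeff_lmul.
rewrite [in LHS]mcoeff_lmul.
rewrite (msupp_lconj f) (msupp_lconj g).
rewrite raddf_sum.
apply: eq_bigr => i _.
rewrite raddf_sum; apply: eq_bigr => j _.
rewrite (mcoeff_lconj f) (mcoeff_lconj g).
by rewrite raddfMn [X in X *+ _]rmorphM.
Qed.

Lemma perturb1_tens (L : laurent) (u : functional) (f g : laurent) :
  perturb1 L u (tens f g) = u (tens (lmul L f) g).
Proof.
rewrite /perturb1 /=; congr (u _); rewrite /tens /lmul.
rewrite (malg_lin_comp (mulz1 L)) [RHS](malg_lin_comp (malg_lin _)).
transitivity (malg_lin (fun i : int => malg_lin (fun k : int => malg_lin
  (fun j : int => << (k + i, j) >> : laurent2) (lconj g)) L) f).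
  apply: eq_malg_lin => i /=; rewrite (malg_lin_comp (mulz1 L)).
  rewrite malg_lin_exchange; apply: eq_malg_lin => j /=.
  by rewrite [mulz1 _ _]malg_linU scale1r.
apply: (etrans (malg_lin_exchange _ _ _)); apply: eq_malg_lin => k /=.
rewrite [RHS](malg_lin_comp (malg_lin _)); apply: eq_malg_lin => i /=.
by rewrite malg_linU scale1r.
Qed.

Lemma perturb2_tens (L : laurent) (u : functional) (f g : laurent) :
  perturb2 L u (tens f g) = u (tens f (lmul L g)).
Proof.
rewrite /perturb2 /=; congr (u _); rewrite /tens lconj_lmul /lmul.
rewrite (malg_lin_comp (mulz2c L)); apply: eq_malg_lin => i /=.
rewrite (malg_lin_comp (mulz2c L)) [RHS](malg_lin_comp (malg_lin _)).
transitivity (malg_lin (fun k : int => malg_lin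
  (fun j : int => << (i, k + j) >> : laurent2) (lconj g)) (lconj L)).
  rewrite malg_lin_exchange; apply: eq_malg_lin => j /=.
  by rewrite [mulz2c _ _]malg_linU scale1r.
apply: eq_malg_lin => k /=; rewrite [RHS](malg_lin_comp (malg_lin _)).
apply: eq_malg_lin => j /=.
by rewrite malg_linU scale1r.
Qed.

Definition prepared (n : nat) (L : laurent) : Prop :=
  [/\ forall k : int, k \in msupp L -> `|k| <= n%:Z,
      L@_(n%:Z) != 0 & L@_(- n%:Z) != 0].

(* The polynomial z^n L(z), for L supported in [-n, n]. *)
Definition shift_poly (n : nat) (L : laurent) : {poly C} :=
  \poly_(i < n.*2.+1) L@_(i%:Z - n%:Z).

(* zs = [:: (zeta_1, m_1); ...; (zeta_d, m_d)] lists the distinct zeros of L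
   in C \ {0} with their multiplicities; the list is complete because the
   multiplicities add up to 2n. *)
Definition zeros_of (n : nat) (L : laurent) (zs : seq (C * nat)) : Prop :=
  [/\ uniq [seq p.1 | p <- zs],
      forall p, p \in zs ->
        [/\ p.1 != 0, (0 < p.2)%N & mup p.1 (shift_poly n L) = p.2]
    & (\sum_(p <- zs) p.2)%N = n.*2].

Definition jet_nodes (zs : seq (C * nat)) : seq (C * nat) :=
  [seq (p.1, k) | p <- zs, k <- iota 0 p.2].

Definition jet (n : nat) (zs : seq (C * nat)) (f : laurent) : 'rV[C]_n.*2 :=
  \row_(j < n.*2)
    let: (zeta, k) := nth (0, 0%N) (jet_nodes zs) j in
    leval (iter k lderiv f) zeta / k`!%:R.

End LaurentPolynomials.

Section Quasideterminants.
Variables (F : fieldType) (m : nat).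

(* Theta_* M = D - C A^-1 B, meaningful if the block A is invertible. *)
Definition last_qdet (M : 'M[F]_(m + 1)) : F :=
  (drsubmx M - dlsubmx M *m invmx (ulsubmx M) *m ursubmx M) 0 0.

(* The square matrix with i-th row [r i | c i], 0 <= i <= m. *)
Definition bordered (r : nat -> 'rV[F]_m) (c : nat -> F) : 'M[F]_(m + 1) :=
  \matrix_(i < m + 1) row_mx (r i) (c i)%:M.

End Quasideterminants.

Section GaussBorel.
Variable R : realType.
Local Notation C := R[i]%C.
Implicit Types (G S T : nat -> nat -> C) (H : nat -> C).

Definition leading (N : nat) G : 'M[C]_N := \matrix_(i, j) G i j.

Definition quasidefinite G : Prop := forall N, \det (leading N G) != 0.

Definition lower_unitriangular S : Prop :=
  (forall k, S k k = 1) /\ (forall k l, (k < l)%N -> S k l = 0).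

Definition ctrans (m n : nat) (A : 'M[C]_(m, n)) : 'M[C]_(n, m) :=
  map_mx Num.conj A^T.

(* G = S1^-1 H (S2^-1)^dagger.  Since S1, S2 are lower triangular, leading
   blocks commute with these inverses and products, so that the identity of
   semi-infinite matrices is the family of identities of leading blocks. *)
Definition is_gauss_borel G (F : (nat -> nat -> C) * (nat -> C) * (nat -> nat -> C)) :
    Prop :=
  let: (S1, H, S2) := F in
  [/\ lower_unitriangular S1, lower_unitriangular S2,
      forall k, H k != 0
    & forall N, leading N G =
        invmx (leading N S1) *m diag_mx (\row_(k < N) H k)
          *m ctrans (invmx (leading N S2))].

Lemma det_ctrans n (A : 'M[C]_n) : \det (ctrans A) = (\det A)^*.
Proof. by rewrite det_map_mx det_tr. Qed.

Lemma left_orthogonalize G : quasidefinite G ->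
  exists2 S, lower_unitriangular S &
    forall k l, (l < k)%N -> \sum_(j < k.+1) S k j * G j l = 0.
Proof.
move=> qG.
pose w k : 'rV[C]_k := - (\row_(j < k) G k j) *m invmx (leading k G).
pose S k j := if insub j is Some i then w k 0 i else (j == k)%:R.
have SE k (i : 'I_k) : S k i = w k 0 i by rewrite /S valK.
have Skk k : S k k = 1 by rewrite /S insubF ?ltnn ?eqxx.
exists S; first split=> // k l kl.
  by rewrite /S insubF ?ltnNge ?(ltnW kl) //; case: eqP kl => // ->; rewrite ltnn.
move=> k l lk; rewrite big_ord_recr /= Skk mul1r.
have /(congr1 (fun M : 'rV[C]_k => M 0 (Ordinal lk))) :
    w k *m leading k G = - (\row_(j < k) G k j).
  by rewrite mulmxKV // unitmxE unitfE.
rewrite [LHS]mxE [RHS]mxE [X in - X]mxE /= => e.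
rewrite -[RHS](addNr (G k l)) -e; congr (_ + _).
by apply: eq_bigr => j _; rewrite SE [leading _ _ _ _]mxE.
Qed.

Lemma gauss_borel_exists G : quasidefinite G -> exists F, is_gauss_borel G F.
Proof.
move=> qG; have [S1 uS1 oS1] := left_orthogonalize qG.
have [|S2 uS2 oS2] := @left_orthogonalize (fun k l => (G l k)^*).
  move=> N; have -> : leading N (fun k l => (G l k)^*) = ctrans (leading N G).
    by apply/matrixP => i j; rewrite !mxE.
  by rewrite det_ctrans conjC_eq0.
have detS S N : lower_unitriangular S -> \det (leading N S) = 1.
  move=> [S1d S0]; rewrite det_trig; last first.
    by apply/is_trig_mxP => i j ij; rewrite mxE S0.
  by rewrite big1 // => i _; rewrite mxE.
have uniS S N : lower_unitriangular S -> leading N S \in unitmx.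
  by move=> uS; rewrite unitmxE detS // unitr1.
have sumS S (f : nat -> C) k N : lower_unitriangular S -> (k < N)%N ->
    \sum_(j < N) S k j * f j = \sum_(j < k.+1) S k j * f j.
  move=> [_ S0] kN; rewrite [RHS](big_ord_widen N (fun j => S k j * f j)) //.
  rewrite [RHS]big_mkcond; apply: eq_bigr => j _.
  by case: ltnP => // kj; rewrite S0 // mul0r.
pose H k := \sum_(j < k.+1) S1 k j * G j k.
have D N : leading N S1 *m leading N G *m ctrans (leading N S2)
    = diag_mx (\row_(k < N) H k).
  have L (i j : 'I_N) : (leading N S1 *m leading N G) i j
      = \sum_(a < i.+1) S1 i a * G a j.
    rewrite mxE -(sumS _ (G^~ j) _ N uS1 (ltn_ord i)). apply: eq_bigr => a _.
    by rewrite !mxE.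
  have Rr (i j : 'I_N) : (leading N G *m ctrans (leading N S2)) i j
      = (\sum_(a < j.+1) S2 j a * (G i a)^*)^*.
    rewrite mxE -(sumS _ (fun a => (G i a)^*) _ N uS2 (ltn_ord j)) rmorph_sum.
    by apply: eq_bigr => a _; rewrite !mxE rmorphM /= conjCK mulrC.
  apply/matrixP => i j; rewrite [RHS]mxE mxE; case: (ltngtP i j) => [ij|ji|ij].
  - have -> : (i == j) = false by case: eqP ij => // ->; rewrite ltnn.
    transitivity ((leading N S1 *m (leading N G *m ctrans (leading N S2))) i j).
      by rewrite mulmxA mxE.
    rewrite mxE big1 // => a _; rewrite mxE; case: (leqP a i) => ai.
      by rewrite Rr oS2 ?conjC0 ?mulr0 // (leq_ltn_trans ai).
    by rewrite (proj2 uS1) // mul0r.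
  - have -> : (i == j) = false by case: eqP ji => // ->; rewrite ltnn.
    rewrite big1 // => a _; rewrite L !mxE; case: (leqP a j) => aj.
      by rewrite oS1 ?mul0r // (leq_ltn_trans aj).
    by rewrite (proj2 uS2) // conjC0 mulr0.
  - move/val_inj: ij => <-; rewrite eqxx mulr1n (bigD1 i) //= big1 => [|a ai].
      by rewrite L !mxE (proj1 uS2) conjC1 mulr1 addr0.
    rewrite L !mxE; case: (ltngtP a i) => [{}ai|{}ai|/val_inj ae].
    + by rewrite oS1 ?mul0r.
    + by rewrite (proj2 uS2) // conjC0 mulr0.
    + by rewrite ae eqxx in ai.
exists (S1, H, S2); split => // [k|N].
  have : \det (leading k.+1 G) != 0 by apply: qG.
  have := congr1 determinant (D k.+1).
  rewrite !det_mulmx det_ctrans (detS _ _ uS1) (detS _ _ uS2).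
  rewrite conjC1 mul1r mulr1 => ->.
  by rewrite det_diag big_ord_recr /= mulf_eq0 negb_or mxE => /andP[].
have cV : ctrans (leading N S2) *m ctrans (invmx (leading N S2)) = 1%:M.
  rewrite /ctrans -map_mxM -trmx_mul mulVmx ?uniS //.
  by rewrite trmx1 map_mx1.
by rewrite -D !mulmxA mulVmx ?uniS // mul1mx -mulmxA cV mulmx1.
Qed.

(* The factorization of G, which exists (gauss_borelP) and is unique if G is
   quasidefinite; a dummy value otherwise. *)
Definition gauss_borel G : (nat -> nat -> C) * (nat -> C) * (nat -> nat -> C) :=
  xget (fun _ _ => 0, fun _ => 0, fun _ _ => 0) [set F | is_gauss_borel G F]%classic.

Lemma gauss_borelP G : quasidefinite G -> is_gauss_borel G (gauss_borel G).
Proof. by move=> /gauss_borel_exists; apply: xgetPex. Qed.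

End GaussBorel.

Section Biorthogonality.
Variable R : realType.
Local Notation C := R[i]%C.
Implicit Types (u : functional R) (k l : nat) (z : C).

Definition chi k : laurent R :=
  << (if odd k then - (k./2.+1)%:Z else (k./2)%:Z) >>.

Definition gram u k l : C := u (tens (chi k) (chi l)).

Definition S1 u := (gauss_borel (gram u)).1.1.
Definition Hdiag u := (gauss_borel (gram u)).1.2.
Definition S2 u := (gauss_borel (gram u)).2.

(* phi_{a,k} is the k-th entry of S_a chi; the sum stops at k because S_a is
   lower triangular. *)
Definition phi1 u k : laurent R := \sum_(j < k.+1) S1 u k j *: chi j.
Definition phi2 u k : laurent R := \sum_(j < k.+1) S2 u k j *: chi j.

(* K^[l](z1^*, z2) *)
Definition CDkernel u l (z1 z2 : C) : C :=
  \sum_(k < l) (leval (phi2 u k) z1)^* * (Hdiag u k)^-1 * leval (phi1 u k) z2.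

(* The Laurent polynomials z2 |-> K^[l](z^*, z2) and z1 |-> (K^[l](z1^*, z))^*,
   see leval_CDsec and leval_CDsecc. *)
Definition CDsec u l z : laurent R :=
  \sum_(k < l) ((leval (phi2 u k) z)^* * (Hdiag u k)^-1) *: phi1 u k.
Definition CDsecc u l z : laurent R :=
  \sum_(k < l) ((leval (phi1 u k) z)^* * ((Hdiag u k)^-1)^*) *: phi2 u k.

Lemma leval_sum l z (c : nat -> C) (phi : nat -> laurent R) :
  leval (\sum_(k < l) c k *: phi k) z = \sum_(k < l) c k * leval (phi k) z.
Proof.
rewrite /leval linear_sum; apply: eq_bigr => k _.
by rewrite linearZ.
Qed.

Lemma leval_CDsec u l z1 z2 : leval (CDsec u l z1) z2 = CDkernel u l z1 z2.
Proof.
exact: (leval_sum l z2 (fun k => (leval (phi2 u k) z1)^* * (Hdiag u k)^-1)).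
Qed.

Lemma leval_CDsecc u l z1 z2 :
  leval (CDsecc u l z2) z1 = (CDkernel u l z1 z2)^*.
Proof.
rewrite (leval_sum l z1
  (fun k => (leval (phi1 u k) z2)^* * ((Hdiag u k)^-1)^*)) /CDkernel rmorph_sum.
apply: eq_bigr => k _; rewrite !rmorphM /= conjCK.
by rewrite mulrC -mulrA; congr (_ * _); rewrite mulrC.
Qed.

End Biorthogonality.

Section Tau.
Variables (R : realType) (n : nat) (zs : seq (R[i]%C * nat)).

Definition tau (phi : nat -> laurent R) (l : nat) : R[i]%C :=
  \det (\matrix_(i < n.*2) jet n zs (phi (l + i)%N)).

End Tau.

(* Main.v *)
Require Import Defs.
From HB Require Import structures.
From mathcomp Require Import all_boot all_order all_algebra.
From mathcomp Require Import boolp classical_sets reals.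
From mathcomp Require Import complex finmap monalg.
From mathcomp Require Import zify ring.
Import Order.TTheory GRing.Theory Num.Theory.
Local Open Scope ring_scope.


(** Write [B f g] for the sesquilinear form of [u], and let [p], [q], [h] be the
    biorthogonal families and norms of [u], [hp], [hq], [hh] those of the perturbed
    form [B (L f) g].  Everything rests on two remarks.

    Order the powers of [z] as in the CMV sequence, and call CMV degree of a Laurent
    polynomial the position of its last power in this order.  Multiplication by a
    prepared [L] raises the CMV degree by exactly [2n], and multiplies the leading
    coefficient, in position [l], by [c = L_((-1)^l n)] ([cmv_filt_lmul],
    [mcoeff_lmul_lead], [cmv_filt_lmul_inv]).  Moreover the Laurent polynomials whose
    jet along [L] vanishes are the multiples of [L] ([jet_eq0_dvd]).

    First, [L hp_l] has CMV degree [l + 2n] and is orthogonal to everything of CMV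
    degree less than [l], so that it is a combination [sum_i a_i p_(l+i)] with
    [0 <= i <= 2n] and [a_(2n) = c]; pairing it with [hq_l] gives [hh_l = a_0 h_l]
    ([connection]).  Its jet vanishes, which is a linear system for the [a_i] with
    determinant [tau_l]; Cramer's rule, in the form of [last_qdet_relation], turns
    evaluation at [z] and extraction of [a_0] into quasideterminants.

    Second, let [f] have CMV degree at most [l].  As [tau_(l+1)] is nonzero by the
    formula for [hh_l], some [F = f + sum_i b_i p_(l+1+i)], with [0 <= i < 2n], has
    zero jet, hence is [L g] with [g] of CMV degree at most [l].  The added terms are
    orthogonal to [hq_l], and [B (L g) hq_l] is [hh_l] times the leading coefficient
    [b_(2n-1) / c] of [g]; thus [B f hq_l = hh_l b_(2n-1) / c]
    ([christoffel_pairing]).  For [f] the section at [z] of the Christoffel-Darboux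
    kernel, the left side is the conjugate of [hq_l(z)], by the reproducing property.

    The perturbation in the second variable is the same statement for the adjoint
    form [(B g f)^*], which exchanges [p] and [q] and conjugates [h]. *)

(** * Quasideterminants of bordered matrices *)

Section BorderedMatrices.
Set Implicit Arguments.
Unset Strict Implicit.
Variables (F : fieldType) (m : nat).
Implicit Types (r : nat -> 'rV[F]_m) (c : nat -> F).

Lemma bordered_block r c :
  bordered r c = block_mx (\matrix_(i < m) r i) (\col_(i < m) c i)
                          (r m) (c m)%:M.
Proof.
apply/matrixP => i j; rewrite mxE.
case: (split_ordP i) => k ->; case: (split_ordP j) => k' ->;
  rewrite ?block_mxEul ?block_mxEur ?block_mxEdl ?block_mxEdr ?row_mxEl ?row_mxEr /=
    ?mxE ?ord1 ?addn0 //.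
Qed.

Lemma last_qdet_bordered r c :
  last_qdet (bordered r c) =
  c m - (r m *m invmx (\matrix_(i < m) r i) *m \col_(i < m) c i) 0 0.
Proof.
rewrite bordered_block /last_qdet block_mxKdr block_mxKdl block_mxKul block_mxKur.
by rewrite [LHS]mxE [X in X + _]mxE eqxx [X in _ + X]mxE.
Qed.

(** Block elimination of the border: the Schur complement of the upper left block
    is the last quasideterminant. *)
Lemma det_last_qdet r c : \matrix_(i < m) r i \in unitmx ->
  \det (bordered r c) =
  \det (\matrix_(i < m) r i) * last_qdet (bordered r c).
Proof.
rewrite last_qdet_bordered bordered_block.
set A := \matrix_(i < m) r i; set b := \col_(i < m) c i => uA.
have -> : block_mx A b (r m) (c m)%:M =
    block_mx A 0 (r m) 1%:M *m
    block_mx 1%:M (invmx A *m b) 0 ((c m)%:M - r m *m invmx A *m b).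
  rewrite mulmx_block !mulmx1 !mul1mx !mul0mx !addr0 mulKVmx //.
  by rewrite mulmxA addrC subrK.
rewrite det_mulmx det_lblock det_ublock !det1 mulr1 mul1r; congr (_ * _).
by rewrite det_mx11 [LHS]mxE [X in X + _]mxE eqxx [X in _ + X]mxE.
Qed.

(** Cramer's rule: a linear relation among the rows expresses the last row
    through the first [m] ones, and the last quasideterminant applies the same
    combination to the border. *)
Lemma last_qdet_relation r c (a : nat -> F) :
  \matrix_(i < m) r i \in unitmx ->
  \sum_(i < m.+1) a i *: r i = 0 ->
  a m * last_qdet (bordered r c) = \sum_(i < m.+1) a i * c i.
Proof.
rewrite last_qdet_bordered; set A := \matrix_(i < m) r i => uA.
rewrite !big_ord_recr /= => rel.
have aA : (\row_(i < m) a i) *m A = - (a m *: r m).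
  apply: (addIr (a m *: r m)); rewrite addNr -rel mulmx_sum_row; congr (_ + _).
  by apply: eq_bigr => i _; rewrite mxE rowK.
rewrite mulrBr addrC; congr (_ + _).
have -> : - (a m * (r m *m invmx A *m \col_i c i) 0 0) =
    ((\row_(i < m) a i) *m \col_(i < m) c i) 0 0.
  have -> : \row_(i < m) a i = - (a m *: r m) *m invmx A by rewrite -aA mulmxK.
  by rewrite mulNmx -scalemxAl mulNmx -scalemxAl [RHS]mxE; congr (- _); rewrite [RHS]mxE.
by rewrite mxE; apply: eq_bigr => i _; rewrite !mxE.
Qed.

Lemma det_bordered_delta r (i0 : nat) : (i0 <= m)%N ->
  \det (bordered r (fun i => (i == i0)%:R)) =
  (-1) ^+ (i0 + m) * \det (\matrix_(i < m) r (bump i0 i)).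
Proof.
move=> i0m.
pose f i j : F := if insub j is Some k then r i 0 k else (i == i0)%:R.
have -> : bordered r (fun i => (i == i0)%:R) = \matrix_(i < m + 1, j < m + 1) f i j.
  apply/matrixP => i j; rewrite !mxE /f; case: splitP => k jk.
    by rewrite jk valK.
  by rewrite insubF ?jk ?mxE ?ord1 ?eqxx // addn0 ltnn.
have -> : \det (\matrix_(i < m + 1, j < m + 1) f i j) =
    \det (\matrix_(i < m.+1, j < m.+1) f i j) by rewrite addn1.
pose I0 : 'I_m.+1 := Ordinal (i0m : i0 < m.+1)%N.
have fmax (i : 'I_m.+1) : f i (ord_max : 'I_m.+1) = (i == I0)%:R.
  by rewrite /f insubF //= ltnn.
rewrite (expand_det_col _ ord_max) (bigD1 I0) //= [X in _ + X]big1 => [|i iI0].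
  rewrite addr0 mxE fmax eqxx mul1r /cofactor; congr (_ * \det _).
  apply/matrixP => i j; rewrite !mxE lift_max /f.
  by rewrite valK.
by rewrite mxE fmax (negPf iI0) mul0r.
Qed.

End BorderedMatrices.

(** * Laurent polynomials as shifted polynomials *)

Section Laurent.
Set Implicit Arguments.
Unset Strict Implicit.
Variable R : realType.
Local Notation C := R[i]%C.
Local Notation laurent := (laurent R).
Implicit Types (f g L : laurent) (P Q : {poly C}) (N k : int) (z : C).

Lemma leval_linear z : linear (fun f => leval f z : C^o).
Proof. exact: (malg_lin_linear (fun k : int => z ^ k : C^o)). Qed.

HB.instance Definition _ :=
  GRing.isLinear.Build C laurent laurent *:%R (@lderiv R) (malg_lin_linear _).

Lemma lmul_suml (I : Type) (s : seq I) (F : I -> laurent) g :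
  lmul (\sum_(i <- s) F i) g = \sum_(i <- s) lmul (F i) g.
Proof. by rewrite /lmul linear_sum. Qed.

Lemma lmul_linear L : linear (lmul L).
Proof.
have E f : lmul L f = malg_lin (fun j : int => malg_lin (fun i : int =>
    << (i + j)%R >> : laurent) L) f by exact: malg_lin_exchange.
by move=> c f g; rewrite !E malg_lin_linear.
Qed.

HB.instance Definition _ L :=
  GRing.isLinear.Build C laurent laurent *:%R (lmul L) (lmul_linear L).

Lemma malgUZ (c : C) k : << c *g k >> = c *: << k >> :> laurent.
Proof. by apply/malgP => j; rewrite mcoeffZ !mcoeffU mulr_natr. Qed.

Lemma lmulU (a b : C) (i j : int) :
  lmul << a *g i >> << b *g j >> = << a * b *g i + j >> :> laurent.
Proof. by rewrite /lmul !malg_linU scalerA -malgUZ. Qed.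

Lemma mcoeff_lmulr L f k :
  (lmul L f)@_k = \sum_(i <- msupp L) L@_i * f@_(k - i).
Proof.
rewrite mcoeff_lmul; apply: eq_bigr => i _.
case: (msuppP f (k - i)) => [kf|kf].
  rewrite (big_fsetD1 (k - i)) //= subrKC eqxx mulr1n big1_fset ?addr0 // => j.
  rewrite in_fsetD1 => /andP[jk _] _; case: eqP => // e.
  by move: jk; rewrite -e [i + j]addrC addrK eqxx.
rewrite mulr0 big_seq big1 // => j jf; case: eqP => // e.
by move: kf; rewrite -e [i + j]addrC addrK jf.
Qed.

Lemma mcoeff_lderiv f k : (lderiv f)@_k = (k + 1)%:~R * f@_(k + 1).
Proof.
have -> : (lderiv f)@_k =
    \sum_(j <- msupp f) if j == k + 1 then (k + 1)%:~R * f@_(k + 1) else 0.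
  rewrite /lderiv /malg_lin raddf_sum; apply: eq_bigr => j _ /=.
  rewrite mcoeffZ mcoeffU; have -> : (j - 1 == k) = (j == k + 1) by lia.
  by case: eqP => [->|_]; rewrite ?mulr1n ?mulr0n ?mulr0 // mulrC.
case: (msuppP f (k + 1)) => [kf|kf].
  rewrite (big_fsetD1 (k + 1)) //= eqxx big1_fset ?addr0 // => j.
  by rewrite in_fsetD1 => /andP[/negPf-> _].
by rewrite mulr0; apply: big1 => j _; case: ifP.
Qed.

(** The Laurent polynomial [z^-N P(z)]; every Laurent polynomial has this form,
    which gives access to divisibility and multiplicities of roots in [{poly C}]. *)
Definition laurent_of N P : laurent :=
  \sum_(i < size P) << P`_i *g (i%:Z - N) >>.

Lemma mcoeff_laurent_of N P k :
  (laurent_of N P)@_k = if 0 <= k + N then P`_(absz (k + N)%R) else 0.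
Proof.
rewrite /laurent_of raddf_sum /=.
case: ifP => [kN|kN].
  have eqi i : (i%:Z - N == k) = (i == absz (k + N)%R) by apply/eqP/eqP; lia.
  under eq_bigr => i _ do rewrite mcoeffU eqi.
  case: (ltnP (absz (k + N)%R) (size P)) => s.
    rewrite (bigD1 (Ordinal s)) //= eqxx mulr1n big1 ?addr0 // => i /negPf.
    by rewrite -val_eqE /= => ->.
  rewrite nth_default // big1 // => i _; case: eqP => // e.
  by move: s; rewrite -e leqNgt ltn_ord.
rewrite big1 // => i _; rewrite mcoeffU; case: eqP => // e.
by move: kN; rewrite -e; lia.
Qed.

Fact laurent_of_linear N : linear (laurent_of N).
Proof.
move=> c P Q; apply/malgP => k.
rewrite mcoeffD mcoeffZ !mcoeff_laurent_of; case: ifP => _.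
  by rewrite coefD coefZ.
by rewrite mulr0 addr0.
Qed.

HB.instance Definition _ N :=
  GRing.isLinear.Build C {poly C} laurent *:%R (laurent_of N) (laurent_of_linear N).

Lemma laurent_ofX N (i : nat) : laurent_of N 'X^i = << i%:Z - N >>.
Proof.
apply/malgP => k; rewrite mcoeff_laurent_of mcoeffU coefXn.
case: ifP => h; last by case: eqP => // e; move: h; rewrite -e; lia.
by congr (_%:R); apply/eqP/eqP; lia.
Qed.

Lemma leval_laurent_of N P z : z != 0 -> leval (laurent_of N P) z = z ^ (- N) * P.[z].
Proof.
move=> z0; rewrite /leval linear_sum /= horner_coef mulr_sumr.
apply: eq_bigr => i _; rewrite malg_linU expfzDr // mulrC [in RHS]mulrCA.
by rewrite [RHS]mulrC mulrC [_ *: _]mulrC.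
Qed.

Lemma lmul_laurent_of N M P Q :
  lmul (laurent_of N P) (laurent_of M Q) = laurent_of (N + M) (P * Q).
Proof.
have -> : P * Q = \sum_(i < size P) \sum_(j < size Q) P`_i * Q`_j *: 'X^(i + j).
  rewrite -[P in LHS]coefK -[Q in LHS]coefK !poly_def mulr_suml.
  apply: eq_bigr => i _; rewrite mulr_sumr; apply: eq_bigr => j _.
  by rewrite -scalerAl -scalerAr scalerA exprD.
rewrite [LHS]lmul_suml [RHS]linear_sum; apply: eq_bigr => i _ /=.
rewrite [LHS]linear_sum [RHS]linear_sum; apply: eq_bigr => j _ /=.
rewrite linearZ /= laurent_ofX lmulU malgUZ.
by congr (_ *: << _ *g _ >>); lia.
Qed.

Lemma lderiv_laurent_of N P :
  lderiv (laurent_of N P) = laurent_of (N + 1) ('X * P^`() - N%:~R *: P).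
Proof.
apply/malgP => k; rewrite mcoeff_lderiv !mcoeff_laurent_of addrA [k + 1 + N]addrAC.
case: ifP => [kN|]; last by rewrite mulr0.
rewrite coefB coefZ coefXM coef_deriv.
set i := absz _.
have -> : (k + 1)%:~R = i%:R - N%:~R :> C.
  by rewrite -[i%:R]/(i%:Z%:~R) -rmorphB; congr (_%:~R); rewrite /i; lia.
rewrite mulrBl; congr (_ - _); case: eqP => [->|i0]; first by rewrite mul0r.
by rewrite prednK ?lt0n; [rewrite mulr_natl | apply/eqP].
Qed.

Lemma shift_polyK (n : nat) f : (forall k, k \in msupp f -> `|k| <= n%:Z) ->
  laurent_of n (shift_poly n f) = f.
Proof.
move=> fn; apply/malgP => k; rewrite mcoeff_laurent_of.
case: (msuppP f k) => [kf|kf].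
  have := fn _ kf => kn; rewrite ifT; last by lia.
  by rewrite coef_poly ifT; [congr (f@__); lia | lia].
case: ifP => // kn; rewrite coef_poly; case: ifP => // _.
by rewrite -[RHS](mcoeff_outdom kf); congr (f@__); lia.
Qed.

Lemma msupp_bounded f : exists n : nat, forall k, k \in msupp f -> `|k| <= n%:Z.
Proof.
exists (\max_(k <- msupp f) absz k)%N => k kf.
rewrite -abszE lez_nat; exact: (@leq_bigmax_seq _ _ xpredT absz _ kf isT).
Qed.

Lemma leval_lmul f g z : z != 0 -> leval (lmul f g) z = leval f z * leval g z.
Proof.
move=> z0; have [N /shift_polyK <-] := msupp_bounded f.
have [M /shift_polyK <-] := msupp_bounded g.
rewrite lmul_laurent_of !leval_laurent_of // hornerM opprD expfzDr //.
by rewrite mulrACA.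
Qed.

End Laurent.

(** * Spectral jets and divisibility *)

Section Jets.
Set Implicit Arguments.
Unset Strict Implicit.
Variable R : realType.
Local Notation C := R[i]%C.
Local Notation laurent := (laurent R).
Implicit Types (f g L : laurent) (P Q : {poly C}) (z : C).
Implicit Types (zs : seq (C * nat)).

(** [X P' - N P] is the numerator of the derivative of [z^-N P].  For
    [P = (X - z)^s.+1 Q] with [Q(z) != 0], it equals [(X - z)^s] times a polynomial
    with value [(s.+1) z Q(z)] at [z]: since [z != 0], the multiplicity drops by
    exactly one. *)
Lemma dvdp_XsubC_euler P (N : int) z (m : nat) : z != 0 ->
  (('X - z%:P) ^+ m.+1 %| P) =
  (P.[z] == 0) && (('X - z%:P) ^+ m %| 'X * P^`() - N%:~R *: P).
Proof.
move=> z0; have [->|P0] := eqVneq P 0.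
  by rewrite dvdp0 horner0 eqxx deriv0 mulr0 scaler0 subr0 dvdp0.
have [[|s] [Q]] := multiplicity_XsubC P z; rewrite P0 /= => Qz PE.
  rewrite expr0 mulr1 in PE; rewrite PE.
  rewrite [Q.[z] == 0](negPf Qz) /=; apply/negP => d; case/negP: Qz.
  by rewrite -dvdp_XsubCl; apply: dvdp_trans d; rewrite exprS dvdp_mulr.
set T : {poly C} := 'X * (Q^`() * ('X - z%:P) + s.+1%:R *: Q)
  - N%:~R *: (Q * ('X - z%:P)).
have -> : 'X * P^`() - N%:~R *: P = T * ('X - z%:P) ^+ s.
  rewrite PE derivM deriv_exp derivXsubC mul1r /T -!mul_polyC exprS -mulr_natl.
  by rewrite -polyC_natr; ring.
have -> : P.[z] == 0 by rewrite PE hornerM horner_exp hornerXsubC subrr expr0n mulr0.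
have s2 : (1 < size ('X - z%:P)%R)%N by rewrite size_XsubC.
have cop (U : {poly C}) k : ~~ root U z -> coprimep (('X - z%:P) ^+ k) U.
  by move=> Uz; rewrite coprimep_expl // coprimep_sym coprimep_XsubC.
rewrite PE Gauss_dvdpr ?cop // dvdp_Pexp2l // ltnS /= Gauss_dvdpr ?dvdp_Pexp2l //.
apply: cop; rewrite rootE /T hornerD hornerN hornerZ !hornerM hornerD hornerM hornerZ.
rewrite hornerX hornerXsubC subrr !mulr0 oppr0 addr0 add0r.
by rewrite !mulf_neq0 // pnatr_eq0.
Qed.

(** Taylor coefficients detect the order of a zero also after division by a power
    of the variable, as long as the point is not the origin. *)
Lemma jet_zero_dvdp P (N : int) z (m : nat) : z != 0 ->
  (forall k, (k < m)%N -> leval (iter k (@lderiv R) (laurent_of N P)) z = 0) <->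
  ('X - z%:P) ^+ m %| P.
Proof.
move=> z0; elim: m P N => [|m IHm] P N; first by rewrite expr0 dvd1p.
rewrite (dvdp_XsubC_euler _ N) //.
have z1 : z ^ (- N) != 0 by rewrite expfz_neq0.
split=> [h|/andP[/eqP Pz d] [|k]].
- apply/andP; split.
    by have /= := h 0%N isT; rewrite leval_laurent_of // => /eqP; rewrite mulf_eq0 (negPf z1).
  by apply/(IHm _ (N + 1)) => k km; rewrite -lderiv_laurent_of -iterSr; apply: h.
- by rewrite /= leval_laurent_of // Pz mulr0.
- by rewrite ltnS iterSr lderiv_laurent_of; apply: (proj2 (IHm _ _) d).
Qed.

Lemma iter_lderiv_linear k : linear (iter k (@lderiv R)).
Proof. by elim: k => // k IHk c f g; rewrite !iterS IHk linearP. Qed.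

Fact jet_linear n zs : linear (@jet R n zs).
Proof.
move=> c f g; apply/rowP => j; rewrite !mxE; case: nth => z k.
by rewrite iter_lderiv_linear [leval _ _]leval_linear mulrDl mulrA.
Qed.

HB.instance Definition _ n zs :=
  GRing.isLinear.Build C laurent 'rV[C]_n.*2 *:%R (@jet R n zs) (jet_linear n zs).

Lemma jet_eq0 n zs f : (\sum_(p <- zs) p.2)%N = n.*2 ->
  (jet n zs f = 0) <->
  (forall p, p \in zs -> forall k, (k < p.2)%N -> leval (iter k (@lderiv R) f) p.1 = 0).
Proof.
move=> sz.
have szn : size (jet_nodes zs) = n.*2.
  rewrite size_allpairs_dep sumnE big_map -sz; apply: eq_bigr => p _.
  by rewrite size_iota.
split=> [j0 p pzs k kp|h].
  have pk : (p.1, k) \in jet_nodes zs.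
    by apply/allpairsPdep; exists p, k; rewrite mem_iota.
  have := pk; rewrite -index_mem szn => ilt.
  move/rowP/(_ (Ordinal ilt)): j0; rewrite !mxE /= nth_index // => /eqP.
  by rewrite mulf_eq0 invr_eq0 pnatr_eq0 (gtn_eqF (fact_gt0 k)) orbF => /eqP.
apply/rowP => j; rewrite !mxE.
have /(mem_nth (0, 0%N)) : (j < size (jet_nodes zs))%N by rewrite szn.
case/allpairsPdep => p [k [pzs]]; rewrite mem_iota => kp ->.
by rewrite h // mul0r.
Qed.

Lemma dvdp_prod_XsubC zs P : uniq [seq p.1 | p <- zs] ->
  (forall p, p \in zs -> ('X - p.1%:P) ^+ p.2 %| P) ->
  \prod_(p <- zs) ('X - p.1%:P) ^+ p.2 %| P.
Proof.
elim: zs => [|p zs IH] /=; first by rewrite big_nil dvd1p.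
case/andP=> pzs uzs h; rewrite big_cons Gauss_dvdp; last first.
  apply: coprimep_expl; rewrite coprimep_sym coprimep_XsubC rootE horner_prod.
  rewrite prodf_seq_neq0; apply/allP => q qzs; rewrite horner_exp hornerXsubC.
  rewrite expf_neq0 // subr_eq0; apply: contraNneq pzs => ->.
  exact: map_f.
rewrite h ?mem_head //=; apply: IH => // q qzs.
by apply: h; rewrite in_cons qzs orbT.
Qed.

Lemma size_prod_exp_XsubC zs :
  size (\prod_(p <- zs) ('X - p.1%:P) ^+ p.2) = (\sum_(p <- zs) p.2).+1.
Proof.
elim: zs => [|p zs IH]; first by rewrite !big_nil size_poly1.
rewrite !big_cons size_mul ?IH ?size_exp_XsubC ?addSn ?addnS //.
  by rewrite expf_neq0 ?polyXsubC_eq0.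
by rewrite -size_poly_eq0 IH.
Qed.

(** The jet along [L] vanishes exactly on the multiples of [L]: by the
    prescribed multiplicities, [z^n L] is a scalar multiple of the product of
    the powers of the [X - zeta_i], and these powers are pairwise coprime. *)
Lemma jet_eq0_dvd n L zs f : prepared n L -> zeros_of n L zs ->
  (jet n zs f = 0) <-> (exists g, f = lmul L g).
Proof.
move=> [Lsupp Ln _] [uzs zsP szs]; rewrite jet_eq0 //.
set S := shift_poly n L.
have LE : L = laurent_of n S by rewrite shift_polyK.
have S0 : S != 0.
  apply: contraNneq Ln => S0; have := congr1 (fun P : {poly C} => P`_(n.*2)) S0.
  by rewrite coef0 coef_poly ltnSn => e; apply/eqP; rewrite -[RHS]e; congr (L@__); lia.
have dS p : p \in zs -> ('X - p.1%:P) ^+ p.2 %| S.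
  by case/zsP => _ _ mp; rewrite -mup_geq // mp.
have [N /shift_polyK fE] := msupp_bounded f; rewrite -fE.
set P := shift_poly N f.
split=> [h|[g gE] p pzs].
  have dPS : \prod_(p <- zs) ('X - p.1%:P) ^+ p.2 %= S.
    rewrite -dvdp_size_eqp ?dvdp_prod_XsubC // eqn_leq dvdp_leq ?dvdp_prod_XsubC //=.
    (* The multiplicities add up to [2n], which is the largest degree that
       [z^n L] can have. *)
    have -> : size (\prod_(p <- zs) ('X - p.1%:P) ^+ p.2) = n.*2.+1.
      by rewrite size_prod_exp_XsubC szs.
    exact: size_poly.
  have : S %| P.
    rewrite -(eqp_dvdl _ dPS); apply: dvdp_prod_XsubC => // p pzs.
    by have [p0 _ _] := zsP p pzs; apply/(jet_zero_dvdp _ N) => //; apply: h.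
  case/dvdpP => Q ->; exists (laurent_of (N%:Z - n%:Z) Q).
  by rewrite LE lmul_laurent_of mulrC; congr (laurent_of _ _); lia.
have [p0 _ _] := zsP p pzs.
have [M gM] := msupp_bounded g; rewrite gE LE -(shift_polyK gM) lmul_laurent_of.
by apply/jet_zero_dvdp => //; rewrite dvdp_mulr // dS.
Qed.

End Jets.

(** * The CMV filtration *)

Section Filtration.
Set Implicit Arguments.
Unset Strict Implicit.
Variable R : realType.
Local Notation C := R[i]%C.
Local Notation laurent := (laurent R).
Implicit Types (f g L : laurent) (k m n : nat) (j : int).

(** The exponent of the [k]-th power of [z] in the CMV order
    [1, z^-1, z, z^-2, z^2, ...]; [cmv_idx] is its inverse. *)
Definition cmv_exp k : int := if odd k then - (k./2.+1)%:Z else (k./2)%:Z.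

Definition cmv_idx j : nat :=
  match j with Posz k => k.*2 | Negz k => k.*2.+1 end.

(** [cmv_idx j] is the maximum of [2 j] and [- 2 j - 1], which makes bounds on it
    linear inequalities. *)
Lemma leq_cmv_idx k j :
  (k <= cmv_idx j)%N = (k%:Z <= 2 * j) || (k%:Z <= - (2 * j) - 1).
Proof. by case: j => i /=; lia. Qed.

Lemma cmv_expK k : cmv_idx (cmv_exp k) = k.
Proof.
by rewrite /cmv_exp -[RHS](odd_double_half k); case: (odd k).
Qed.

Lemma cmv_idxK j : cmv_exp (cmv_idx j) = j.
Proof.
case: j => i; rewrite /cmv_exp /= ?odd_double /= ?doubleK //.
by rewrite uphalf_double NegzE.
Qed.

(** The span of the first [k] entries of the CMV sequence. *)
Definition cmv_filt k f := forall j, (k <= cmv_idx j)%N -> f@_j = 0.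

Definition cmv_monic k f := cmv_filt k.+1 f /\ f@_(cmv_exp k) = 1.

Lemma cmv_filtW k m f : (k <= m)%N -> cmv_filt k f -> cmv_filt m f.
Proof. by move=> km fk j mj; apply: fk; apply: leq_trans mj. Qed.

Lemma cmv_filtDZ k (c : C) f g :
  cmv_filt k f -> cmv_filt k g -> cmv_filt k (c *: f + g).
Proof. by move=> fk gk j kj; rewrite mcoeffD mcoeffZ fk // gk // mulr0 addr0. Qed.

Lemma cmv_filt_sum k (I : finType) (c : I -> C) (F : I -> laurent) :
  (forall i, cmv_filt k (F i)) -> cmv_filt k (\sum_i c i *: F i).
Proof.
move=> Fk j kj; rewrite raddf_sum big1 // => i _.
by rewrite /= mcoeffZ Fk // mulr0.
Qed.

Lemma cmv_filt_pred k f :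
  cmv_filt k.+1 f -> f@_(cmv_exp k) = 0 -> cmv_filt k f.
Proof.
move=> fk f0 j; rewrite leq_eqVlt => /orP[/eqP kj|]; last exact: fk.
by rewrite -(cmv_idxK j) -kj.
Qed.

Lemma cmv_filt_coef k m f : cmv_filt k f -> (k <= m)%N -> f@_(cmv_exp m) = 0.
Proof. by move=> fk km; apply: fk; rewrite cmv_expK. Qed.

Lemma cmv_filt_exists f : exists k, cmv_filt k f.
Proof.
have [N fN] := msupp_bounded f; exists (N.*2.+2) => j; rewrite leq_cmv_idx => jN.
by apply: mcoeff_outdom; apply/negP => /fN; lia.
Qed.

Lemma cmv_filt_chi k : cmv_filt k.+1 (chi R k).
Proof.
move=> j kj; rewrite mcoeffU; case: eqP => // e; move: kj.
by rewrite -e -/(cmv_exp k) cmv_expK ltnn.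
Qed.

Lemma cmv_filt_expand (p : nat -> laurent) m f :
  (forall k, cmv_monic k (p k)) -> cmv_filt m f ->
  exists a : nat -> C, f = \sum_(j < m) a j *: p j.
Proof.
move=> pm; elim: m f => [|m IH] f fm.
  exists (fun=> 0); rewrite big_ord0; apply/malgP => j.
  by rewrite mcoeff0; apply: fm.
have [|a aE] := IH (- f@_(cmv_exp m) *: p m + f).
  apply: cmv_filt_pred; first by apply: cmv_filtDZ => //; have [] := pm m.
  by have [_ p1] := pm m; rewrite mcoeffD mcoeffZ p1 mulr1 addNr.
exists (fun i => if i == m then f@_(cmv_exp m) else a i).
rewrite big_ord_recr /= eqxx.
under eq_bigr => i _ do rewrite (ltn_eqF (ltn_ord i)).
by rewrite -aE scaleNr addrAC addNr add0r.
Qed.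

Lemma mcoeff_expand_last (p : nat -> laurent) (a : nat -> C) k :
  (forall k, cmv_monic k (p k)) ->
  (\sum_(j < k.+1) a j *: p j)@_(cmv_exp k) = a k.
Proof.
move=> pm; rewrite big_ord_recr /= mcoeffD mcoeffZ.
have [_ ->] := pm k; rewrite mulr1 raddf_sum big1 ?add0r // => j _.
by have [pj _] := pm j; rewrite /= mcoeffZ (cmv_filt_coef pj) ?mulr0.
Qed.

(** Multiplication by [z^i] with [|i| <= n] raises the CMV index by at most [2n];
    this bound is reached only by [i = n] on even entries and by [i = - n]
    on odd ones. *)
Lemma cmv_filt_lmul n k L f : prepared n L ->
  cmv_filt k f -> cmv_filt (k + n.*2) (lmul L f).
Proof.
move=> [Ln _ _] fk j; rewrite leq_cmv_idx => kj.
rewrite mcoeff_lmulr big_seq big1 // => i /Ln iL.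
by rewrite fk ?mulr0 // leq_cmv_idx; lia.
Qed.

Lemma mcoeff_lmul_lead n k L f : prepared n L -> cmv_filt k.+1 f ->
  (lmul L f)@_(cmv_exp (k + n.*2)) = L@_((-1) ^+ k * n%:Z) * f@_(cmv_exp k).
Proof.
move=> [Ln Lp Lm] fk; rewrite mcoeff_lmulr; set i0 := (-1) ^+ k * n%:Z.
have i0E : i0 = if odd k then - n%:Z else n%:Z.
  by rewrite /i0 -signr_odd; case: (odd k); rewrite ?expr0 ?expr1 ?mulN1r ?mul1r.
have i0L : i0 \in msupp L.
  by rewrite -mcoeff_neq0 i0E; case: (odd k).
have e0 : cmv_exp (k + n.*2) - i0 = cmv_exp k.
  rewrite /cmv_exp oddD odd_double addbF halfD odd_double andbF add0n doubleK i0E.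
  by case: (odd k); lia.
rewrite (big_fsetD1 i0) //= e0 big1_fset ?addr0 // => i.
rewrite in_fsetD1 => /andP[ii0 /Ln iL] _.
rewrite fk ?mulr0 // leq_cmv_idx; move: ii0; rewrite i0E.
have := odd_double_half k.
rewrite /cmv_exp oddD odd_double addbF halfD odd_double andbF add0n doubleK.
by case: (odd k); lia.
Qed.

(** No cancellation occurs in the leading term of [L g], as both extreme
    coefficients of [L] are nonzero. *)
Lemma cmv_filt_lmul_inv n k L g : prepared n L ->
  cmv_filt (k + n.*2) (lmul L g) -> cmv_filt k g.
Proof.
move=> pL Lg; have [m] := cmv_filt_exists g.
elim: m => [|m IH] gm; first exact: cmv_filtW gm.
have [mk|km] := ltnP m k; first exact: cmv_filtW gm.
apply: IH; apply: cmv_filt_pred => //.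
have := mcoeff_lmul_lead pL gm; rewrite (cmv_filt_coef Lg) ?leq_add2r //.
move/esym/eqP; rewrite mulf_eq0 => /orP[|/eqP //].
have [_ Lp Lm] := pL; rewrite -signr_odd.
by case: (odd m); rewrite ?expr0 ?expr1 ?mulN1r ?mul1r ?(negPf Lp) ?(negPf Lm).
Qed.

End Filtration.

(** * Biorthogonal families *)

Section Biorthogonal.
Set Implicit Arguments.
Unset Strict Implicit.
Variable R : realType.
Local Notation C := R[i]%C.
Local Notation laurent := (laurent R).
Implicit Types (f g L : laurent) (B : laurent -> laurent -> C).
Implicit Types (p q : nat -> laurent) (h : nat -> C).

Definition sesquilinear B :=
  (forall c f f' g, B (c *: f + f') g = c * B f g + B f' g) /\
  (forall c f g g', B f (c *: g + g') = c^* * B f g + B f g').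

Record biorthogonal B p q h : Prop := Biorthogonal {
  biortho_monicl : forall k, cmv_monic k (p k);
  biortho_monicr : forall k, cmv_monic k (q k);
  biortho_norm : forall k, h k != 0;
  biorthoE : forall k l, B (p k) (q l) = h k *+ (k == l)
}.

Lemma sesquilinear_suml B m (a : nat -> C) p g : sesquilinear B ->
  B (\sum_(i < m) a i *: p i) g = \sum_(i < m) a i * B (p i) g.
Proof.
move=> [Bl _]; elim: m => [|m IH].
  by rewrite !big_ord0; have := Bl (-1) 0 0 g; rewrite scaler0 addr0 mulN1r addNr.
by rewrite !big_ord_recr /= addrC Bl IH addrC.
Qed.

Lemma sesquilinear_sumr B m (a : nat -> C) q f : sesquilinear B ->
  B f (\sum_(i < m) a i *: q i) = \sum_(i < m) (a i)^* * B f (q i).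
Proof.
move=> [_ Br]; elim: m => [|m IH].
  rewrite !big_ord0; have := Br (-1) f 0 0.
  by rewrite scaler0 addr0 rmorphN rmorph1 mulN1r addNr.
by rewrite !big_ord_recr /= addrC Br IH addrC.
Qed.

Lemma sesquilinear_swap B : sesquilinear B -> sesquilinear (fun f g => (B g f)^*).
Proof.
move=> [Bl Br]; split=> c f g g'; first by rewrite Br rmorphD rmorphM /= conjCK.
by rewrite Bl rmorphD rmorphM.
Qed.

(** Conjugating keeps the adjoint form linear in its first argument; this is the
    symmetry that exchanges the two perturbations. *)
Lemma biorthogonal_swap B p q h : biorthogonal B p q h ->
  biorthogonal (fun f g => (B g f)^*) q p (fun k => (h k)^*).
Proof.
move=> [pm qm h0 E]; split=> // [k|k l]; first by rewrite conjC_eq0.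
by rewrite E rmorphMn eq_sym; case: eqP => // ->.
Qed.

Section Orthogonality.
Variables (B : laurent -> laurent -> C) (p q : nat -> laurent) (h : nat -> C).
Hypotheses (sB : sesquilinear B) (bo : biorthogonal B p q h).

Lemma biortho_expandl m (a : nat -> C) l : (l < m)%N ->
  B (\sum_(i < m) a i *: p i) (q l) = a l * h l.
Proof.
move=> lm; rewrite sesquilinear_suml // (bigD1 (Ordinal lm)) //= (biorthoE bo) eqxx.
rewrite big1 ?addr0 // => i; rewrite -val_eqE /= (biorthoE bo) => /negPf->.
by rewrite mulr0.
Qed.

Lemma biortho_expandr m (a : nat -> C) l : (l < m)%N ->
  B (p l) (\sum_(i < m) a i *: q i) = (a l)^* * h l.
Proof.
move=> lm; rewrite sesquilinear_sumr // (bigD1 (Ordinal lm)) //= (biorthoE bo) eqxx.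
rewrite big1 ?addr0 // => i; rewrite -val_eqE /= (biorthoE bo) eq_sym => /negPf->.
by rewrite mulr0.
Qed.

Lemma biortho_filtr k g : cmv_filt k g -> B (p k) g = 0.
Proof.
case/(cmv_filt_expand (biortho_monicr bo)) => a ->.
rewrite sesquilinear_sumr // big1 // => i _.
by rewrite (biorthoE bo) (gtn_eqF (ltn_ord i)) mulr0.
Qed.

Lemma biortho_monic_norm k g : cmv_monic k g -> B (p k) g = h k.
Proof.
case=> gk g1; have [a gE] := cmv_filt_expand (biortho_monicr bo) gk.
move: g1; rewrite gE (mcoeff_expand_last _ _ (biortho_monicr bo)) => a1.
by rewrite biortho_expandr // a1 rmorph1 mul1r.
Qed.

(** The Christoffel-Darboux kernel reproduces: pairing its section at [z] with
    [g] in the span of the first [l] entries evaluates [g] at [z], up to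
    conjugation. *)
Definition cd_section l z : laurent :=
  \sum_(k < l) ((leval (q k) z)^* / h k) *: p k.

Lemma cd_section_reproducing l z g : cmv_filt l g ->
  B (cd_section l z) g = (leval g z)^*.
Proof.
case/(cmv_filt_expand (biortho_monicr bo)) => a ->.
rewrite (sesquilinear_suml _ (fun k => (leval (q k) z)^* / h k)) //.
rewrite leval_sum rmorph_sum; apply: eq_bigr => k _.
rewrite biortho_expandr // rmorphM /= mulrA [X in X * h k]mulrAC divfK.
  by rewrite mulrC.
exact: biortho_norm bo k.
Qed.

Lemma cmv_filt_cd_section l z : cmv_filt l (cd_section l z).
Proof.
apply: cmv_filt_sum => k; have [pk _] := biortho_monicl bo k.
exact: cmv_filtW pk.
Qed.

End Orthogonality.

(** * The Christoffel transformation of a sesquilinear form *)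

Section Christoffel.
Variables (B : laurent -> laurent -> C) (n : nat) (L : laurent) (zs : seq (C * nat)).
Variables (p q : nat -> laurent) (h : nat -> C).
Variables (hp hq : nat -> laurent) (hh : nat -> C).
Hypotheses (n_gt0 : (0 < n)%N) (sB : sesquilinear B).
Hypotheses (pL : prepared n L) (zL : zeros_of n L zs).
Hypotheses (bo : biorthogonal B p q h).
Hypotheses (hbo : biorthogonal (fun f g => B (lmul L f) g) hp hq hh).
Variable l : nat.
Hypothesis tau_neq0 : tau n zs p l != 0.

Let J := jet n zs.
Let c := L@_((-1) ^+ l * n%:Z).

Let c_neq0 : c != 0.
Proof.
have [_ Lp Lm] := pL; rewrite /c -signr_odd.
by case: (odd l); rewrite ?expr0 ?expr1 ?mulN1r ?mul1r.
Qed.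

Let sLB : sesquilinear (fun f g => B (lmul L f) g).
Proof.
have [Bl Br] := sB; split=> *; last by rewrite Br.
by rewrite linearP Bl.
Qed.

Let r i := J (p (l + i)%N).

Let r_unit : \matrix_(i < n.*2) r i \in unitmx.
Proof. by rewrite unitmxE unitfE. Qed.

(** [L hp_l] has CMV degree [l + 2n] and is left-orthogonal to the first [l]
    entries, which leaves only [p_l], ..., [p_(l+2n)] in its expansion. *)
Lemma connection : exists a : nat -> C,
  [/\ lmul L (hp l) = \sum_(i < n.*2.+1) a i *: p (l + i)%N,
      \sum_(i < n.*2.+1) a i *: r i = 0, a n.*2 = c & hh l = a 0%N * h l].
Proof.
have [hpl hp1] := biortho_monicl hbo l.
have [a LE] : exists a : nat -> C,
    lmul L (hp l) = \sum_(i < l + n.*2.+1) a i *: p i.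
  apply: cmv_filt_expand; first exact: biortho_monicl bo.
  by rewrite -addSnnS; apply: cmv_filt_lmul.
(* [a_j h_j] is the pairing with [q_j], and the perturbed form makes [hp_l]
   orthogonal to all CMV degrees below [l]. *)
have a0 j : (j < l)%N -> a j = 0.
  move=> jl; apply/eqP; have h0 := biortho_norm bo j.
  rewrite -(mulIr_eq0 _ (mulIf h0)) -(@biortho_expandl _ _ _ _ sB bo (l + n.*2.+1)).
    by rewrite -LE (biortho_filtr sLB hbo) //; have [qj _] := biortho_monicr bo j;
       exact: cmv_filtW qj.
  by rewrite ltn_addr.
have LE' : lmul L (hp l) = \sum_(i < n.*2.+1) a (l + i)%N *: p (l + i)%N.
  rewrite LE big_split_ord /= big1 ?add0r // => i _.
  by rewrite a0 ?scale0r /=.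
exists (fun i => a (l + i)%N); split => //.
  have J0 : J (lmul L (hp l)) = 0 by apply/(jet_eq0_dvd _ pL zL); exists (hp l).
  by rewrite -[RHS]J0 LE' /J linear_sum; apply: eq_bigr => i _; rewrite linearZ.
  have := mcoeff_lmul_lead pL hpl; rewrite hp1 mulr1 -/c => <-.
  rewrite LE addnS mcoeff_expand_last //; exact: biortho_monicl bo.
rewrite addn0 -(biortho_monic_norm sLB hbo (biortho_monicr hbo l)) LE'.
rewrite (sesquilinear_suml _ (fun i => a (l + i)%N) (fun i => p (l + i)%N)) //.
rewrite big_ord_recl /= addn0 (biortho_monic_norm sB bo (biortho_monicr hbo l)).
rewrite big1 ?addr0 // => i _; rewrite (biortho_filtr sB bo) ?mulr0 //.
have [hqf _] := biortho_monicr hbo l; apply: cmv_filtW hqf.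
by rewrite /bump /= addnS ltnS leq_addr.
Qed.

Lemma christoffel_poly z : z != 0 -> leval L z != 0 ->
  let M := bordered r (fun i => leval (p (l + i)%N) z) in
  leval (hp l) z = c / leval L z * last_qdet M /\
  leval (hp l) z = c / leval L z * (tau n zs p l)^-1 * \det M.
Proof.
move=> z0 Lz M; have [a [LE rel an _]] := connection.
have E : leval (hp l) z = c / leval L z * last_qdet M.
  rewrite mulrAC -an (last_qdet_relation _ r_unit rel).
  rewrite -(leval_sum _ z a (fun i => p (l + i)%N)) -LE.
  by rewrite leval_lmul // mulrAC divff // mul1r.
split=> //; rewrite E det_last_qdet // -/(tau n zs p l) -!mulrA.
by rewrite [(tau n zs p l)^-1 * _]mulKf.
Qed.

Lemma christoffel_norm_qdet :
  hh l = c * h l * last_qdet (bordered r (fun i => (i == 0%N)%:R)).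
Proof.
have [a [_ rel an ->]] := connection.
rewrite mulrAC -an (last_qdet_relation _ r_unit rel) big_ord_recl /= mulr1 big1.
  by rewrite addr0.
by move=> i _; rewrite mulr0.
Qed.

Lemma christoffel_norm_tau : hh l = c * h l * (tau n zs p l.+1 / tau n zs p l).
Proof.
rewrite christoffel_norm_qdet; congr (_ * _).
have := det_last_qdet (fun i => (i == 0%N)%:R) r_unit.
rewrite det_bordered_delta // add0n -signr_odd odd_double expr0 mul1r.
rewrite -/(tau n zs p l) => /(canLR (mulKf tau_neq0)) <-.
rewrite mulrC; congr (\det _ / _); apply/row_matrixP => i; rewrite !rowK /r.
by rewrite /bump leq0n add1n addSnnS.
Qed.

Let tauS_neq0 : tau n zs p l.+1 != 0.
Proof.
have := biortho_norm hbo l; rewrite christoffel_norm_tau.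
by rewrite !mulf_eq0 !negb_or => /andP[_ /andP[]].
Qed.

Let rS f i := if (i < n.*2)%N then J (p (l.+1 + i)%N) else J f.

Let rS_E f : \matrix_(i < n.*2) rS f i = \matrix_(i < n.*2) J (p (l.+1 + i)%N).
Proof. by apply/row_matrixP => i; rewrite !rowK /rS ltn_ord. Qed.

Let rS_unit f : \matrix_(i < n.*2) rS f i \in unitmx.
Proof. by rewrite rS_E unitmxE unitfE. Qed.

(** Adding a combination of [p_(l+1)], ..., [p_(l+2n)] to [f] does not change its
    pairing with [hq_l], and can be chosen to cancel the jet of [f]. The result is
    a multiple [L g], with [g] of CMV degree at most [l], and its pairing with
    [hq_l] only sees the top coefficient of [g]. *)
Lemma christoffel_pairing f : cmv_filt l.+1 f ->
  B f (hq l) =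
  hh l / c * last_qdet (bordered (rS f) (fun i => (i == n.*2.-1)%:R)).
Proof.
move=> ff; set M := bordered _ _.
have lt1 : (n.*2.-1 < n.*2)%N by rewrite prednK ?double_gt0.
(* The solution of [J f + sum_k b_k J (p_(l+1+k)) = 0], extended by [1] at the
   index of the row [J f]. *)
pose b : 'rV[C]_n.*2 := - J f *m invmx (\matrix_(i < n.*2) rS f i).
pose a i : C := if insub i is Some k then b 0 k else 1.
have ab (k : 'I_n.*2) : a k = b 0 k by rewrite /a valK.
have an : a n.*2 = 1 by rewrite /a insubF ?ltnn.
have rel : \sum_(i < n.*2.+1) a i *: rS f i = 0.
  rewrite big_ord_recr /= an scale1r {2}/rS ltnn.
  apply: (addIr (- J f)); rewrite addrK add0r -(mulmxKV (rS_unit f) (- J f)).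
  rewrite mulmx_sum_row; apply: eq_bigr => k _.
  by rewrite rowK ab.
have ME : last_qdet M = a n.*2.-1.
  rewrite -[LHS]mul1r -an (last_qdet_relation _ (rS_unit f) rel).
  rewrite (bigD1 (Ordinal (ltnW lt1 : n.*2.-1 < n.*2.+1)%N)) //= eqxx mulr1 big1 ?addr0 //.
  by move=> k; rewrite -val_eqE /= => /negPf->; rewrite mulr0.
pose F := f + \sum_(i < n.*2) a i *: p (l.+1 + i)%N.
have JF : J F = 0.
  rewrite -rel big_ord_recr /= an scale1r {2}/rS ltnn addrC /F /J linearD linear_sum.
  by congr (_ + _); apply: eq_bigr => i _; rewrite linearZ /rS ltn_ord.
have [g FE] : exists g, F = lmul L g by apply/(jet_eq0_dvd _ pL zL).
have pf i : cmv_filt (l.+1 + i).+1 (p (l.+1 + i)%N).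
  by have [] := biortho_monicl bo (l.+1 + i)%N.
have Ff : cmv_filt (l.+1 + n.*2) F.
  rewrite /F -[f]scale1r; apply: cmv_filtDZ; first by apply: cmv_filtW ff; rewrite leq_addr.
  by apply: cmv_filt_sum => i; apply: cmv_filtW (pf i); rewrite -addnS leq_add2l.
have gf : cmv_filt l.+1 g by apply: (cmv_filt_lmul_inv pL); rewrite -FE.
(* Only the last added term reaches CMV degree [l + 2n]. *)
have gl : c * g@_(cmv_exp l) = a n.*2.-1.
  rewrite -(mcoeff_lmul_lead pL gf) -FE /F mcoeffD (cmv_filt_coef ff) ?add0r; last first.
    by rewrite -addn1 leq_add2l double_gt0.
  rewrite raddf_sum (bigD1 (Ordinal lt1)) //= mcoeffZ.
  have [_] := biortho_monicl bo (l.+1 + n.*2.-1)%N.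
  rewrite addSnnS prednK ?double_gt0 // => ->.
  rewrite mulr1 big1 ?addr0 // => i; rewrite -val_eqE /= => ii.
  rewrite mcoeffZ (cmv_filt_coef (pf i)) ?mulr0 //.
  by have := ltn_ord i; lia.
have [d gE] := cmv_filt_expand (biortho_monicl hbo) gf.
have dl : d l = g@_(cmv_exp l).
  by rewrite gE (mcoeff_expand_last _ _ (biortho_monicl hbo)).
have -> : B f (hq l) = B F (hq l).
  rewrite /F addrC -[X in B (X + _)]scale1r (proj1 sB) mul1r.
  rewrite (sesquilinear_suml _ a (fun i => p (l.+1 + i)%N)) // big1 ?add0r // => i _.
  rewrite (biortho_filtr sB bo) ?mulr0 //.
  by have [hqf _] := biortho_monicr hbo l; apply: cmv_filtW hqf; rewrite leq_addr.
rewrite FE {1}gE (biortho_expandl sLB hbo) // dl ME -gl mulrA divfK //.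
by rewrite mulrC.
Qed.

Lemma christoffel_adjoint z :
  let K := cd_section p q h l.+1 z in
  let M := bordered (rS K) (fun i => (i == n.*2.-1)%:R) in
  let N := \matrix_(i < n.*2)
    (if (i < n.*2.-1)%N then J (p (l.+1 + i)%N) else J K) in
  (leval (hq l) z)^* = hh l / c * last_qdet M /\
  (leval (hq l) z)^* = - (h l / tau n zs p l) * \det N.
Proof.
move=> K M N; have [hql _] := biortho_monicr hbo l.
have E : (leval (hq l) z)^* = hh l / c * last_qdet M.
  by rewrite -(cd_section_reproducing sB bo _ hql) christoffel_pairing //;
     apply: cmv_filt_cd_section bo _ _.
split=> //; rewrite E.
have lt1 : (n.*2.-1 < n.*2)%N by rewrite prednK ?double_gt0.
have := det_last_qdet (fun i => (i == n.*2.-1)%:R) (rS_unit K).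
rewrite det_bordered_delta 1?ltnW // -/M rS_E -/(tau n zs p l.+1).
have -> : (-1) ^+ (n.*2.-1 + n.*2) = -1 :> C.
  rewrite -signr_odd oddD odd_double addbF -[odd _]negbK -oddS prednK ?double_gt0 //.
  by rewrite odd_double.
have -> : \matrix_(i < n.*2) rS K (bump n.*2.-1 i) = N.
  apply/row_matrixP => i; rewrite !rowK /rS /bump.
  have := ltn_ord i; case: (ltnP i n.*2.-1) => h1 h2.
    by rewrite add0n h2.
  by rewrite ifF //; apply/negbTE; lia.
move=> /(canLR (mulKf tauS_neq0)) <-; rewrite christoffel_norm_tau.
move: (tau n zs p l) (tau n zs p l.+1) tau_neq0 tauS_neq0 => t t' t0 t'0.
by field; rewrite t0 t'0 c_neq0.
Qed.

End Christoffel.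

End Biorthogonal.

(** * Biorthogonality from the Gauss-Borel factorization *)

Section GaussBorelFamilies.
Set Implicit Arguments.
Unset Strict Implicit.
Variable R : realType.
Local Notation C := R[i]%C.
Local Notation laurent := (laurent R).
Implicit Types (u : functional R) (f g L : laurent).

Definition form u f g : C := u (tens f g).

Lemma sesquilinear_form u : sesquilinear (form u).
Proof.
have lconj_semilinear (c : C) f g : lconj (c *: f + g) = c^* *: lconj f + lconj g.
  apply/malgP => k; rewrite mcoeff_lconj mcoeffD mcoeffZ rmorphD rmorphM.
  by rewrite [RHS]mcoeffD [X in _ = X + _]mcoeffZ (mcoeff_lconj f) (mcoeff_lconj g).
have tensE f g : tens f g = malg_lin (fun j : int =>
    malg_lin (fun i : int => << (i, j) >> : laurent2 R) f) (lconj g).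
  exact: malg_lin_exchange.
split=> c f g k; rewrite /form; first by rewrite /tens malg_lin_linear linearP.
by rewrite !tensE lconj_semilinear malg_lin_linear linearP.
Qed.

Lemma cmv_monic_chi k : cmv_monic k (chi R k).
Proof. by split; [exact: cmv_filt_chi | rewrite mcoeffUU]. Qed.

Lemma cmv_monic_unitriangular (S : nat -> nat -> C) k : lower_unitriangular S ->
  cmv_monic k (\sum_(j < k.+1) S k j *: chi R j).
Proof.
move=> [S1 _]; split.
  apply: cmv_filt_sum => j; have [cj _] := cmv_monic_chi j.
  exact: cmv_filtW cj.
by rewrite mcoeff_expand_last //; exact: cmv_monic_chi.
Qed.

Lemma unitriangular_widen (S : nat -> nat -> C) k N : lower_unitriangular S ->
  (k < N)%N -> \sum_(j < k.+1) S k j *: chi R j = \sum_(j < N) S k j *: chi R j.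
Proof.
move=> [_ S0] kN; rewrite (big_ord_widen N (fun j => S k j *: chi R j)) //.
rewrite big_mkcond; apply: eq_bigr => j _.
by case: ltnP => // kj; rewrite S0 // scale0r.
Qed.

Lemma leading_unitriangular_unit (S : nat -> nat -> C) N :
  lower_unitriangular S -> leading N S \in unitmx.
Proof.
move=> [S1 S0]; rewrite unitmxE det_trig.
  by rewrite big1 ?unitr1 // => i _; rewrite mxE.
by apply/is_trig_mxP => i j ij; rewrite mxE S0.
Qed.

(** The entries of [S1 G S2^dagger] are the pairings of the rows of [S1 chi] with
    those of [S2 chi], so the factorization of [G] is biorthogonality. *)
Lemma biorthogonal_phi u : quasidefinite (gram u) ->
  biorthogonal (form u) (phi1 u) (phi2 u) (Hdiag u).
Proof.
move=> /gauss_borelP; rewrite /phi1 /phi2 /Hdiag /S1 /S2.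
case: (gauss_borel _) => [[T1 H] T2] /= [uT1 uT2 H0 GE].
split=> // [k|k|k l]; [exact: cmv_monic_unitriangular | exact: cmv_monic_unitriangular |].
set N := (maxn k l).+1.
have kN : (k < N)%N by rewrite ltnS leq_maxl.
have lN : (l < N)%N by rewrite ltnS leq_maxr.
have D : leading N T1 *m leading N (gram u) *m ctrans (leading N T2) =
    diag_mx (\row_(k < N) H k).
  have V : ctrans (invmx (leading N T2)) *m ctrans (leading N T2) = 1%:M.
    rewrite /ctrans -map_mxM -trmx_mul mulmxV ?leading_unitriangular_unit //.
    by rewrite trmx1 map_mx1.
  by rewrite GE !mulmxA mulmxV ?leading_unitriangular_unit // mul1mx -mulmxA V mulmx1.
have sB := sesquilinear_form u.
rewrite (unitriangular_widen uT1 kN) (unitriangular_widen uT2 lN).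
rewrite (sesquilinear_sumr _ (T2 l)) //.
under eq_bigr => j _ do rewrite (sesquilinear_suml _ (T1 k)) //.
move/matrixP/(_ (Ordinal kN) (Ordinal lN)): D; rewrite [RHS]mxE !mxE -val_eqE /= => <-.
apply: eq_bigr => j _; rewrite !mxE mulrC; congr (_ * _).
by apply: eq_bigr => i _; rewrite !mxE.
Qed.

Lemma eq_biorthogonal (B B' : laurent -> laurent -> C) p q h :
  (forall f g, B f g = B' f g) -> biorthogonal B p q h -> biorthogonal B' p q h.
Proof. by move=> BB' [pm qm h0 E]; split=> // k l; rewrite -BB'. Qed.

Lemma CDsecc_cd_section u l z :
  CDsecc u l z = cd_section (phi2 u) (phi1 u) (fun k => (Hdiag u k)^*) l z.
Proof. by apply: eq_bigr => k _; rewrite fmorphV. Qed.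

End GaussBorelFamilies.

Theorem theorem1 (R : realType) (n : nat) (u : functional R) :
  (1 <= n)%N -> quasidefinite (gram u) ->
   (forall (L : laurent R) (zs : seq (R[i]%C * nat)),
      prepared n L -> zeros_of n L zs ->
      quasidefinite (gram (perturb1 L u)) ->
      forall l : nat, (n.*2 <= l)%N -> tau n zs (phi1 u) l != 0 ->
      let hu := perturb1 L u in
      let J := jet n zs in
      let tau_ := tau n zs (phi1 u) in
      let Lln := L@_((-1) ^+ l * n%:Z) in
      [/\ forall z : R[i]%C, z != 0 -> leval L z != 0 ->
            let M := bordered (fun i => J (phi1 u (l + i)%N))
                              (fun i => leval (phi1 u (l + i)%N) z) in
            leval (phi1 hu l) z = Lln / leval L z * last_qdet M /\
            leval (phi1 hu l) z = Lln / leval L z * (tau_ l)^-1 * \det M,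
          (let M := bordered (fun i => J (phi1 u (l + i)%N))
                             (fun i => (i == 0%N)%:R) in
           Hdiag hu l = Lln * Hdiag u l * last_qdet M /\
           Hdiag hu l = Lln * Hdiag u l * (tau_ l.+1 / tau_ l))
        & forall z : R[i]%C, z != 0 ->
            let M := bordered
              (fun i => if (i < n.*2)%N then J (phi1 u (l.+1 + i)%N)
                        else J (CDsec u l.+1 z))
              (fun i => (i == n.*2.-1)%:R) in
            let N := \matrix_(i < n.*2)
              (if (i < n.*2.-1)%N then J (phi1 u (l.+1 + i)%N)
               else J (CDsec u l.+1 z)) in
            (leval (phi2 hu l) z)^* = Hdiag hu l / Lln * last_qdet M /\
            (leval (phi2 hu l) z)^* = - (Hdiag u l / tau_ l) * \det N])
   /\
   (forall (L : laurent R) (zs : seq (R[i]%C * nat)),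
      prepared n L -> zeros_of n L zs ->
      quasidefinite (gram (perturb2 L u)) ->
      forall l : nat, (n.*2 <= l)%N -> tau n zs (phi2 u) l != 0 ->
      let hu := perturb2 L u in
      let J := jet n zs in
      let tau_ := tau n zs (phi2 u) in
      let Lln := L@_((-1) ^+ l * n%:Z) in
      [/\ forall z : R[i]%C, z != 0 -> leval L z != 0 ->
            let M := bordered (fun i => J (phi2 u (l + i)%N))
                              (fun i => leval (phi2 u (l + i)%N) z) in
            leval (phi2 hu l) z = Lln / leval L z * last_qdet M /\
            leval (phi2 hu l) z = Lln / leval L z * (tau_ l)^-1 * \det M,
          (let M := bordered (fun i => J (phi2 u (l + i)%N))
                             (fun i => (i == 0%N)%:R) in
           (Hdiag hu l)^* = Lln * (Hdiag u l)^* * last_qdet M /\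
           (Hdiag hu l)^* = Lln * (Hdiag u l)^* * (tau_ l.+1 / tau_ l))
        & forall z : R[i]%C, z != 0 ->
            let M := bordered
              (fun i => if (i < n.*2)%N then J (phi2 u (l.+1 + i)%N)
                        else J (CDsecc u l.+1 z))
              (fun i => (i == n.*2.-1)%:R) in
            let N := \matrix_(i < n.*2)
              (if (i < n.*2.-1)%N then J (phi2 u (l.+1 + i)%N)
               else J (CDsecc u l.+1 z)) in
            (leval (phi1 hu l) z)^* = (Hdiag hu l)^* / Lln * last_qdet M /\
            (leval (phi1 hu l) z)^* = - ((Hdiag u l)^* / tau_ l) * \det N]).
Proof.
move=> n_gt0 qG; have sB := sesquilinear_form u; have bo := biorthogonal_phi qG.
split=> L zs pL zL qhG l _ tau0.
  have hbo : biorthogonal (fun f g => form u (lmul L f) g)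
      (phi1 (perturb1 L u)) (phi2 (perturb1 L u)) (Hdiag (perturb1 L u)).
    by apply: eq_biorthogonal (biorthogonal_phi qhG) => f g; apply: perturb1_tens.
  split=> [z z0 Lz||z _].
  - exact: (christoffel_poly sB pL zL bo hbo tau0).
  - split; first exact: (christoffel_norm_qdet sB pL zL bo hbo tau0).
    exact: (christoffel_norm_tau sB pL zL bo hbo tau0).
  - exact: (christoffel_adjoint n_gt0 sB pL zL bo hbo tau0).
(* The second perturbation is the first one for the adjoint form. *)
have hbo : biorthogonal (fun f g => (form u g (lmul L f))^*)
    (phi2 (perturb2 L u)) (phi1 (perturb2 L u)) (fun k => (Hdiag (perturb2 L u) k)^*).
  apply: eq_biorthogonal (biorthogonal_swap (biorthogonal_phi qhG)) => f g.
  by congr (_^*); apply: perturb2_tens.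
have sB' := sesquilinear_swap sB; have bo' := biorthogonal_swap bo.
split=> [z z0 Lz||z _].
- exact: (christoffel_poly sB' pL zL bo' hbo tau0).
- split; first exact: (christoffel_norm_qdet sB' pL zL bo' hbo tau0).
  exact: (christoffel_norm_tau sB' pL zL bo' hbo tau0).
- rewrite CDsecc_cd_section.
  exact: (christoffel_adjoint n_gt0 sB' pL zL bo' hbo tau0).
Qed.
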